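(* Let $L=L_1\sqcup\cdots\sqcup L_p$ be a $p$-component link in $\mathbb{R}^3$ (a union of $p$ disjoint simple closed curves) such that any two components $L_i,L_j$, $i\ne j$, are linked. Then there is a point $c\in\mathbb{R}^3$ such that each plane through $c$ meets at least $\frac{3}{5}p$ components of $L$. In particular, the hull number of $L$ satisfies $u(L)\ge\frac{3}{5}p$.
   Context: A link is an ambient isotopy class of a union of disjoint simple closed curves in $\mathbb{R}^3$; the same letter $L$ is used for a link and for a union of curves representing it. Two components $L_i$ and $L_j$ are linked if the two-component link $L_i\sqcup L_j$ is not split, i.e. it is not ambient isotopic to a link whose two components are separated by a plane. For a union $L$ of disjoint simple closed curves in $\mathbb{R}^3$, the $n$-th hull of $L$ is $$h_n(L)=\{c\in\mathbb{R}^3 : |S\cap L|\ge 2n \text{ for every plane } S\ni c\}.$$ Counting convention for $|S\cap L|$: an isolated intersection point at which the curve does not change sides with respect to $S$ is counted twice; if there is a non-isolated intersection point the count is infinite. The hull number of a link $L$ is $$u(L)=\max\{n : h_n(L')\neq\emptyset \text{ for every union of curves } L' \text{ representing the link } L\}.$$ *)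

(* Defs.v *)
From HB Require Import structures.
From mathcomp Require Import all_boot all_order all_algebra.
From mathcomp Require Import all_classical all_reals all_analysis.

Set Implicit Arguments.
Unset Strict Implicit.
Unset Printing Implicit Defensive.

Import Order.TTheory GRing.Theory Num.Theory.
Import numFieldNormedType.Exports.
Local Open Scope classical_set_scope.
Local Open Scope ring_scope.

(** Curves and links are sets of points of R^3. Everything is topological: no
    smoothness or tameness is imposed on curves or on isotopies. *)

Definition R3 (R : realType) := 'rV[R]_3.

(** [simple_closed_curve K]: K is the image of a circle, presented as [0, 1]
    with its endpoints glued, under a continuous injection. *)
Definition simple_closed_curve (R : realType) (K : set (R3 R)) : Prop :=
  exists gamma : R -> R3 R,
    [/\ {within `[0, 1], continuous gamma},
        gamma 0 = gamma 1,
        {in `[0, 1[ &, injective gamma} &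
        K = gamma @` `[0, 1] ].

Definition disjoint_curves (R : realType) (p : nat)
    (L : 'I_p -> set (R3 R)) : Prop :=
  (forall i, simple_closed_curve (L i)) /\ trivIset setT L.

Definition curve_union (R : realType) (L : set (R3 R)) : Prop :=
  exists p (K : 'I_p -> set (R3 R)),
    disjoint_curves K /\ L = \bigcup_i K i.

Definition homeomorphism (R : realType) (f : R3 R -> R3 R) : Prop :=
  exists g : R3 R -> R3 R,
    [/\ continuous f, continuous g, cancel f g & cancel g f].

Definition ambient_isotopic (R : realType) (A B : set (R3 R)) : Prop :=
  exists H : R -> R3 R -> R3 R,
    [/\ {within `[0, 1] `*` [set: R3 R],
           continuous (fun z : R * R3 R => H z.1 z.2)},
        forall t : R, t \in `[0, 1] -> homeomorphism (H t),
        forall x, H 0 x = x &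
        H 1 @` A = B].

Definition dot (R : realType) (a x : R3 R) : R :=
  \sum_(i < 3) a ord0 i * x ord0 i.

(** Planes are given by an equation [dot a x = d] and are used only with
    [a != 0]; the two sides are the open half-spaces. Replacing (a, d) by
    (- a, - d) swaps the sides, which no notion below distinguishes. *)
Definition plane (R : realType) (a : R3 R) (d : R) : set (R3 R) :=
  [set x | dot a x = d].

Definition side_lt (R : realType) (a : R3 R) (d : R) : set (R3 R) :=
  [set x | dot a x < d].

Definition side_gt (R : realType) (a : R3 R) (d : R) : set (R3 R) :=
  [set x | d < dot a x].

Definition separated_by_plane (R : realType) (A B : set (R3 R)) : Prop :=
  exists (a : R3 R) (d : R),
    [/\ a != 0, A `<=` side_lt a d & B `<=` side_gt a d].

Definition split_link (R : realType) (L : set (R3 R)) : Prop :=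
  exists K1 K2 : set (R3 R),
    [/\ simple_closed_curve K1, simple_closed_curve K2,
        ambient_isotopic L (K1 `|` K2) & separated_by_plane K1 K2].

Definition linked (R : realType) (A B : set (R3 R)) : Prop :=
  ~ split_link (A `|` B).

(** At an isolated point x of the intersection, L is near x an arc that x cuts
    into two pieces, each lying in one of the two open sides. So L changes sides
    at x exactly when points of L on either side accumulate at x. *)
Definition changes_sides (R : realType) (a : R3 R) (d : R)
    (L : set (R3 R)) (x : R3 R) : Prop :=
  closure (L `&` side_lt a d) x /\ closure (L `&` side_gt a d) x.

Definition intersection_count (R : realType) (a : R3 R) (d : R)
    (L : set (R3 R)) : \bar R :=
  let I := plane a d `&` L in
  if `[< I `<=` isolated I >] then
    \esum_(x in I) (if `[< changes_sides a d L x >] then 1%:E else 2%:E)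
  else +oo%E.

Definition hull (R : realType) (n : nat) (L : set (R3 R)) : set (R3 R) :=
  [set c | forall (a : R3 R) (d : R), a != 0 -> plane a d c ->
     ((2 * n)%:R%:E <= intersection_count a d L)%E].

(** The maximum defining the hull number, as a supremum in the extended reals.
    The set of n is nonempty (it contains 0), so the supremum is the maximum
    whenever that set is bounded, and is +oo otherwise. *)
Definition hull_number (R : realType) (L : set (R3 R)) : \bar R :=
  ereal_sup [set n%:R%:E | n in [set n : nat |
    forall L' : set (R3 R), curve_union L' -> ambient_isotopic L L' ->
      hull n L' !=set0]].

(* Main.v *)
(** The only use of linking is that no plane separates two components; hence the
    convex hulls of any two components meet, and all the components missed by a
    given plane lie on the same side of it. So a plane through [c] missing more
    than [2p/5] components puts them all in an open half-space avoiding [c], and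
    it suffices that [c] lie in the hull of every union of more than [2p/5]
    components. By Helly's theorem in R^3 it is enough that any four of these
    hulls meet. Four index sets of size more than [2p/5] always admit two
    indices [i], [j] such that each of the four sets contains [i] or [j]; a
    common point of the hulls of [L i] and [L j] then lies in all four hulls.

    Any ambient isotopic copy of [L] inherits the property that no plane
    separates two components, and a closed curve meeting a plane contributes
    at least 2 to the intersection count, which gives the hull number. *)

Require Import Defs.
From HB Require Import structures.
From mathcomp Require Import all_boot all_order all_algebra.
From mathcomp Require Import all_classical all_reals all_analysis.
From mathcomp Require Import zify ring lra.

Set Implicit Arguments.
Unset Strict Implicit.
Unset Printing Implicit Defensive.

Import Order.TTheory GRing.Theory Num.Theory.
Import numFieldNormedType.Exports.
Local Open Scope classical_set_scope.
Local Open Scope ring_scope.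

(** * Helly's theorem, and covering large index sets by two indices *)

(** By induction on the list: adding one point to a barycenter is a binary convex combination. The
    total weight must stay positive, so this is proved along with membership. *)
Lemma convex_set_barycenter (R : realFieldType) (V : lmodType R)
    (C : set (convex_lmodType V)) (T : Type) (s : seq T) (P : pred T)
    (w : T -> R) (x : T -> V) :
  convex_set C -> (forall i, P i -> 0 < w i) -> (forall i, P i -> C (x i)) ->
  has P s ->
  C ((\sum_(i <- s | P i) w i)^-1 *: \sum_(i <- s | P i) w i *: x i).
Proof.
move=> cC w0 Cx sP.
suff [] : 0 < \sum_(i <- s | P i) w i /\
  C ((\sum_(i <- s | P i) w i)^-1 *: \sum_(i <- s | P i) w i *: x i) by [].
elim: s sP => [//|i s IH] /=; rewrite !big_cons.
case: ifP => [Pi _|//]; have wi0 := w0 _ Pi.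
have [/IH|sP] := boolP (has P s); last first.
  rewrite !big_hasC // !addr0 scalerA mulVf ?gt_eqF // scale1r.
  by split=> //; exact: Cx.
set W := \sum_(j <- s | P j) w j; set X := \sum_(j <- s | P j) _ => -[W0 CX].
have wW0 : 0 < w i + W by rewrite addr_gt0.
split=> //.
have t0 : 0 <= w i / (w i + W) by rewrite divr_ge0 ?ltW.
have t1 : w i / (w i + W) <= 1 by rewrite ler_pdivrMr // mul1r lerDl ltW.
have := cC (x i) (W^-1 *: X) (Itv01 t0 t1) (mem_set (Cx _ Pi)) (mem_set CX).
rewrite inE; congr C; rewrite /conv /=.
rewrite scalerDr !scalerA (mulrC (w i)); congr (_ *: _ + _ *: _).
by rewrite /unstable.onem; field; rewrite !gt_eqF.
Qed.

(** The [n] rows [(x i, 1)] live in dimension [d.+1 < n], so they are linearly dependent; the column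
    of ones makes the dependence affine. *)
Lemma radon (R : realFieldType) (d n : nat) (x : 'I_n -> 'rV[R]_d) :
  (d.+1 < n)%N ->
  exists2 w : 'I_n -> R, exists i, w i != 0 &
    \sum_i w i = 0 /\ \sum_i w i *: x i = 0.
Proof.
move=> dn; pose M := row_mx (\matrix_i x i) (const_mx 1 : 'cV_n).
have : kermx M != 0.
  rewrite -mxrank_eq0 mxrank_ker subn_eq0 -ltnNge.
  by rewrite (leq_ltn_trans (rank_leq_col _)) // addn1.
case/rowV0Pn => v /sub_kermxP; rewrite mul_mx_row -[RHS]row_mx0.
case/eq_row_mx => vx v1 /rV0Pn[i vi0].
exists (v 0); first by exists i.
split.
  have /matrixP/(_ 0 0) := v1; rewrite !mxE => v10; rewrite -[RHS]v10.
  by apply: eq_bigr => j _; rewrite mxE mulr1.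
rewrite -[RHS]vx mulmx_sum_row; by apply: eq_bigr => j _; rewrite rowK.
Qed.

(** Induction on the number of sets. Omitting each set in turn gives points [x k]; an affine
    dependence makes a barycenter of the positively weighted ones equal to one of the negatively
    weighted ones. This Radon point lies in every set. *)
Lemma helly (R : realFieldType) (d : nat) (J : finType)
    (C : J -> set (convex_lmodType 'rV[R]_d)) :
  (forall j, convex_set (C j)) ->
  (forall f : 'I_d.+1 -> J, exists z, forall k, C (f k) z) ->
  exists z, forall j, C j z.
Proof.
move=> cC H.
suff K (A : {set J}) : exists z, forall j, j \in A -> C j z.
  by have [z Cz] := K [set: J]%SET; exists z => j; apply: Cz; rewrite inE.
have [n] := ubnP #|A|; elim: n A => [//|n IH] A; rewrite ltnS => An.
have [Ad|dA] := leqP #|A| d.+1.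
  have [->|[j0 j0A]] := set_0Vmem A; first by exists 0 => j; rewrite inE.
  (* [nth] falls back on the member [j0] when [A] has fewer than [d.+1] elements. *)
  have [z Cz] := H (fun k => nth j0 (enum A) k).
  exists z => j jA.
  have jd : (index j (enum A) < d.+1)%N.
    by rewrite (leq_trans _ Ad) // cardE index_mem mem_enum.
  by have := Cz (Ordinal jd); rewrite /= nth_index // mem_enum.
have xP (k : 'I_#|A|) : exists z, forall j, j \in A :\ enum_val k -> C j z.
  apply: IH; apply: leq_trans An.
  rewrite [X in (_ < X)%N](cardsD1 (enum_val k)).
  by rewrite enum_valP add1n.
have [x {}xP] := choice xP.
have [w [i wi0] [sw swx]] := radon x dA.
have splitw (V : nmodType) (F : 'I_#|A| -> V) :
    (forall k, w k = 0 -> F k = 0) ->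
    \sum_k F k = \sum_(k | 0 < w k) F k + \sum_(k | w k < 0) F k.
  move=> F0; rewrite (bigID (fun k => 0 < w k)) /=; congr (_ + _).
  rewrite big_mkcond [RHS]big_mkcond; apply: eq_bigr => k _.
  by case: ltgtP => // wk; rewrite F0.
have W0 : \sum_(k | w k < 0) - w k = \sum_(k | 0 < w k) w k.
  by apply/eqP; rewrite sumrN eqr_oppLR -addr_eq0 addrC -splitw ?sw.
have X0 : \sum_(k | w k < 0) - w k *: x k = \sum_(k | 0 < w k) w k *: x k.
  under eq_bigr do rewrite scaleNr.
  apply/eqP; rewrite sumrN eqr_oppLR -addr_eq0 addrC -splitw ?swx // => k ->.
  exact: scale0r.
have hpos : has (fun k => 0 < w k) (index_enum 'I_#|A|).
  apply: contraNT wi0 => /hasPn npos; rewrite -oppr_eq0; apply/eqP.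
  apply: (@psumr_eq0P _ _ xpredT (fun k => - w k)) => // [k _|].
    by rewrite oppr_ge0 leNgt npos // mem_index_enum.
  by rewrite sumrN sw oppr0.
have hneg : has (fun k => w k < 0) (index_enum 'I_#|A|).
  apply: contraNT wi0 => /hasPn nneg; apply/eqP.
  apply: (@psumr_eq0P _ _ xpredT w) => // k _.
  by rewrite leNgt nneg // mem_index_enum.
exists ((\sum_(k | 0 < w k) w k)^-1 *: \sum_(k | 0 < w k) w k *: x k) => j jA.
have [k0 ->] : exists k0 : 'I_#|A|, j = enum_val k0.
  by exists (enum_rank_in jA j); rewrite enum_rankK_in.
have xC k : k != k0 -> C (enum_val k0) (x k).
  move=> kk0; apply: xP.
  by rewrite !inE (inj_eq enum_val_inj) eq_sym kk0 enum_valP.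
(* Only [x k0] may fail to lie in the set [k0], so the Radon point is written with the weights of
   the sign that [w k0] does not have. *)
have [wk0|wk0] := ltP 0 (w k0).
  rewrite -W0 -X0; apply: convex_set_barycenter => // k wk.
    by rewrite oppr_gt0.
  by apply: xC; apply: contraTneq wk => ->; rewrite -leNgt ltW.
apply: convex_set_barycenter => // k wk.
by apply: xC; apply: contraTneq wk => ->; rewrite -leNgt.
Qed.

(* Otherwise no three of the sets have a common element, and of two
   complementary pairs of sets at most one has. The pairs of sets that do meet
   then form a star (three pairs through one set) or a triangle (three pairs
   among three sets). The contradiction comes from weighted sums of
   the four cardinals: weights 0 at the centre of the star and 1 elsewhere, or
   weights 2 at the set outside the triangle and 1 elsewhere. *)
Lemma four_large_sets_covered (T : finType) (I : 'I_4 -> {set T}) :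
  (forall k, 2 * #|T| < 5 * #|I k|)%N ->
  exists i j, forall k, i \in I k \/ j \in I k.
Proof.
move=> large; apply: contrapT => nex.
pose k0 : 'I_4 := inord 0; pose k1 : 'I_4 := inord 1.
pose k2 : 'I_4 := inord 2; pose k3 : 'I_4 := inord 3.
have kP (P : 'I_4 -> Prop) : P k0 -> P k1 -> P k2 -> P k3 -> forall k, P k.
  move=> P0 P1 P2 P3 k; rewrite -[k]inord_val.
  by case: k => -[|[|[|[|]]]].
have ne i j : exists k, (i \notin I k) && (j \notin I k).
  apply: contrapT => nk; apply: nex; exists i, j => k.
  apply/orP; apply: contrapT => /negP; rewrite negb_or => nIk.
  by apply: nk; exists k.
have {}ne i j : [|| (i \notin I k0) && (j \notin I k0),
    (i \notin I k1) && (j \notin I k1), (i \notin I k2) && (j \notin I k2) |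
    (i \notin I k3) && (j \notin I k3)].
  have [k] := ne i j; apply: contraTT; rewrite !negb_or => /and4P[n0 n1 n2 n3].
  by move: k; apply: kP.
have card k : #|I k| = (\sum_i (i \in I k))%N by rewrite -sum1_card big_mkcond.
(* Double counting: a bound on the weighted membership of each element is summed over [T]. *)
have weigh (c0 c1 c2 c3 c : nat) :
    (forall i, c0 * (i \in I k0) + c1 * (i \in I k1) + c2 * (i \in I k2)
       + c3 * (i \in I k3) <= c)%N ->
    (c0 * #|I k0| + c1 * #|I k1| + c2 * #|I k2| + c3 * #|I k3| <= c * #|T|)%N.
  move=> le_c; rewrite !card !big_distrr -!big_split /= mulnC.
  rewrite -sum_nat_const; exact: leq_sum.
have mem k : exists i, i \in I k.
  by apply/set0Pn; rewrite -card_gt0; have := large k; lia.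
have [[i0 m0] [i1 m1]] := (mem k0, mem k1).
have [[i2 m2] [i3 m3]] := (mem k2, mem k3).
have [[l0 l1] [l2 l3]] := ((large k0, large k1), (large k2, large k3)).
have dich (P Q : pred T) : (forall i j, P i -> Q j -> False) ->
    (forall i, ~~ P i) \/ (forall i, ~~ Q i).
  move=> PQ; have [[i Pi]|nP] := pselect (exists i, P i); [right|left] => j;
    apply/negP => Hj; [exact: (PQ i j)|by apply: nP; exists j].
have d1 : (forall i, ~~ ((i \in I k0) && (i \in I k1))) \/
          (forall i, ~~ ((i \in I k2) && (i \in I k3))).
  apply: dich => i j /andP[a b] /andP[a' b']; have := ne i j.
  by rewrite a b a' b' !andbF.
have d2 : (forall i, ~~ ((i \in I k0) && (i \in I k2))) \/
          (forall i, ~~ ((i \in I k1) && (i \in I k3))).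
  apply: dich => i j /andP[a b] /andP[a' b']; have := ne i j.
  by rewrite a b a' b' !andbF.
have d3 : (forall i, ~~ ((i \in I k0) && (i \in I k3))) \/
          (forall i, ~~ ((i \in I k1) && (i \in I k2))).
  apply: dich => i j /andP[a b] /andP[a' b']; have := ne i j.
  by rewrite a b a' b' !andbF.
have t0 i : ~~ [&& i \in I k1, i \in I k2 & i \in I k3].
  apply/negP => /and3P[a b c]; have := ne i i0.
  by rewrite a b c m0 !andbF.
have t1 i : ~~ [&& i \in I k0, i \in I k2 & i \in I k3].
  apply/negP => /and3P[a b c]; have := ne i i1.
  by rewrite a b c m1 !andbF.
have t2 i : ~~ [&& i \in I k0, i \in I k1 & i \in I k3].
  apply/negP => /and3P[a b c]; have := ne i i2.
  by rewrite a b c m2 !andbF.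
have t3 i : ~~ [&& i \in I k0, i \in I k1 & i \in I k2].
  apply/negP => /and3P[a b c]; have := ne i i3.
  by rewrite a b c m3 !andbF.
have absurd (A B : Prop) : A -> ~ B -> ~ (A -> B) by tauto.
(* The weights follow the order of the cases. Each cardinal exceeds 2/5 of [#|T|], so total weight 5
   with [c = 2], or 3 with [c = 1], is impossible. *)
case: d1 => e1; case: d2 => e2; case: d3 => e3;
  [move: (weigh 2 1 1 1 2)%N | move: (weigh 1 1 1 0 1)%N
  |move: (weigh 1 1 0 1 1)%N | move: (weigh 1 2 1 1 2)%N
  |move: (weigh 1 0 1 1 1)%N | move: (weigh 1 1 2 1 2)%N
  |move: (weigh 1 1 1 2 2)%N | move: (weigh 0 1 1 1 1)%N];
  apply: absurd => [i|]; try lia;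
  by move: (e1 i) (e2 i) (e3 i) (t0 i) (t1 i) (t2 i) (t3 i);
    do 4!case: (i \in _).
Qed.

(** * Inner product, closed convex hulls and separating planes *)

Lemma dotC (R : realType) (a x : R3 R) : dot a x = dot x a.
Proof. by apply: eq_bigr => i _; rewrite mulrC. Qed.

Lemma dotDr (R : realType) (a x y : R3 R) : dot a (x + y) = dot a x + dot a y.
Proof. by rewrite -big_split; apply: eq_bigr => i _; rewrite mxE mulrDr. Qed.

Lemma dotZr (R : realType) (a : R3 R) (t : R) (x : R3 R) :
  dot a (t *: x) = t * dot a x.
Proof. by rewrite mulr_sumr; apply: eq_bigr => i _; rewrite mxE mulrCA. Qed.

Lemma dotNr (R : realType) (a x : R3 R) : dot a (- x) = - dot a x.
Proof. by rewrite -scaleN1r dotZr mulN1r. Qed.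

Lemma dotNl (R : realType) (a x : R3 R) : dot (- a) x = - dot a x.
Proof. by rewrite dotC dotNr dotC. Qed.

Lemma dot_delta (R : realType) (i : 'I_3) (x : R3 R) :
  dot (delta_mx ord0 i) x = x ord0 i.
Proof.
rewrite /dot (bigD1 i) //= big1 => [|j ji]; rewrite mxE eqxx.
  by rewrite eqxx mul1r addr0.
by rewrite (negbTE ji) mul0r.
Qed.

Lemma dot_ge0 (R : realType) (x : R3 R) : 0 <= dot x x.
Proof. by apply: sumr_ge0 => i _; rewrite -expr2 sqr_ge0. Qed.

Lemma dot_eq0 (R : realType) (x : R3 R) : dot x x = 0 -> x = 0.
Proof.
move=> x0; apply/rowP => i; rewrite mxE; apply/eqP; rewrite -sqrf_eq0 expr2.
apply/eqP; apply: (@psumr_eq0P _ _ xpredT (fun i => x ord0 i * x ord0 i)) => //.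
by move=> j _; rewrite -expr2 sqr_ge0.
Qed.

Lemma dot_sqrD (R : realType) (v u : R3 R) (t : R) :
  dot (v + t *: u) (v + t *: u) = dot v v + 2 * t * dot v u + t ^+ 2 * dot u u.
Proof.
rewrite dotDr dotZr (dotC _ v) (dotC _ u) !dotDr !dotZr (dotC u v); ring.
Qed.

Lemma continuous_dot (R : realType) (T : topologicalType) (f g : T -> R3 R) :
  continuous f -> continuous g -> continuous (fun z => dot (f z) (g z)).
Proof.
move=> cf cg; apply: (continuous_big (@add_continuous R)) => i _ z.
have cc (h : T -> R3 R) : continuous h -> continuous (fun z => h z ord0 i).
  move=> ch t; apply: (@continuous_comp _ _ _ h (fun x : 'rV[R]_3 => x ord0 i)).
    exact: ch.
  exact: coord_continuous.
by apply: cvgM; [exact: (cc f)|exact: (cc g)].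
Qed.

Lemma dot_continuous (R : realType) (a : R3 R) : continuous (dot a).
Proof.
apply: (@continuous_dot _ _ (fun=> a) id); first exact: cst_continuous.
by move=> z; exact: cvg_id.
Qed.

(* The closed convex hull, presented as an intersection of half-spaces so that
   Caratheodory's theorem is not needed to see that it is compact. *)
Definition half_space_hull (R : realType) (A : set (R3 R)) : set (R3 R) :=
  [set x | forall (a : R3 R) (d : R),
     (forall y, A y -> dot a y <= d) -> dot a x <= d].

Lemma sub_half_space_hull (R : realType) (A : set (R3 R)) :
  A `<=` half_space_hull A.
Proof. by move=> x Ax a d; apply. Qed.

Lemma half_space_hullS (R : realType) (A B : set (R3 R)) :
  A `<=` B -> half_space_hull A `<=` half_space_hull B.
Proof. by move=> AB x Ax a d Bd; apply: Ax => y /AB; exact: Bd. Qed.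

Lemma half_space_hull_segment (R : realType) (A : set (R3 R))
    (x y : R3 R) (t : R) :
  half_space_hull A x -> half_space_hull A y -> 0 <= t <= 1 ->
  half_space_hull A (t *: x + (1 - t) *: y).
Proof.
move=> Ax Ay /andP[t0 t1] a d /[dup] /Ax ax /Ay ay; rewrite dotDr !dotZr.
have : t * dot a x <= t * d by rewrite ler_wpM2l.
have : (1 - t) * dot a y <= (1 - t) * d by rewrite ler_wpM2l // subr_ge0.
by lra.
Qed.

Lemma convex_half_space_hull (R : realType) (A : set (R3 R)) :
  convex_set (half_space_hull A : set (convex_lmodType 'rV[R]_3)).
Proof.
move=> x y t; rewrite !inE => Ax Ay.
by apply: half_space_hull_segment => //; rewrite ge0 le1.
Qed.

Lemma closed_half_space_hull (R : realType) (A : set (R3 R)) :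
  closed (half_space_hull A).
Proof.
have -> : half_space_hull A = \bigcap_(ad in [set ad : R3 R * R |
    forall y, A y -> dot ad.1 y <= ad.2]) [set x | dot ad.1 x <= ad.2].
  apply/seteqP; split=> x Ax => [[a d]|a d ad]; first exact: Ax.
  exact: (Ax (a, d)).
apply: closed_bigI => -[a d] _ /=.
apply: (@preimage_closed _ _ (dot a) [set r | r <= d]); last exact: closed_le.
  by move=> x _; exact: dot_continuous.
Qed.

(** Coordinate bounds on [A] are half-space conditions with normals plus or minus a basis vector, so
    the hull inherits them. *)
Lemma compact_half_space_hull (R : realType) (A : set (R3 R)) :
  compact A -> compact (half_space_hull A).
Proof.
move=> /compact_bounded[M [Mr AM]].
apply: (@bounded_closed_compact R 3); last exact: closed_half_space_hull.
exists `|M|; split=> [|N MN x Ax]; first by rewrite num_real.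
have N0 : 0 <= N by rewrite (le_trans _ (ltW MN)).
have {}MN : M < N by rewrite (le_lt_trans (ler_norm _)).
have coord (y : R3 R) i : A y -> `|y ord0 i| <= N.
  move=> /(AM N MN); apply: le_trans; rewrite [leRHS]/Num.norm /= mx_normrE.
  by apply/bigmax_geP; right; exists (ord0, i).
rewrite /= [leLHS]/Num.norm /= mx_normrE; apply: bigmax_le => // -[j i] _ /=.
rewrite (ord1 j) ler_norml lerNl -dot_delta -dotNl.
apply/andP; split; apply: Ax => y /(coord _ i);
  rewrite ?dotNl dot_delta ler_norml.
  by rewrite lerNl => /andP[].
by case/andP.
Qed.

(* The variational inequality of the projection: if it failed, moving from [x]
   towards [x'] by the fraction [s / (s + q)] would bring us closer to [y]. *)
Lemma nearest_point_half_space (R : realType) (A : set (R3 R)) (x y : R3 R) :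
  half_space_hull A x ->
  (forall x', half_space_hull A x' ->
    dot (y - x) (y - x) <= dot (y - x') (y - x')) ->
  forall x', half_space_hull A x' -> dot (y - x) x' <= dot (y - x) x.
Proof.
move=> Ax near_x x' Ax'; set v := y - x; rewrite -subr_ge0 -opprB oppr_ge0.
rewrite -dotNr -dotDr; set u := x' - x; set s := dot v u.
rewrite leNgt; apply/negP => s0; set q := dot u u.
have q0 : 0 <= q by exact: dot_ge0.
have sq0 : 0 < s + q by rewrite ltr_wpDr.
pose t := s / (s + q).
have t0 : 0 < t by rewrite divr_gt0.
have t1 : t <= 1 by rewrite ler_pdivrMr // mul1r lerDl.
have tsq : t * s + t * q = s by rewrite -mulrDr /t divfK // gt_eqF.
have := near_x _ (half_space_hull_segment Ax' Ax _); move=> /(_ t).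
rewrite (ltW t0) t1 => /(_ isT).
have -> : y - (t *: x' + (1 - t) *: x) = v + (- t) *: u.
  by apply/rowP => i; rewrite !mxE; ring.
rewrite -/v dot_sqrD -/s -/q => le0.
have : t * (2 * s) <= t * (t * q) by lra.
by rewrite ler_pM2l //; have := mulr_gt0 t0 s0; lra.
Qed.

(** Take a closest pair [x], [y] of the two compact hulls. Each is the nearest point of its hull to
    the other, so the plane normal to [y - x] midway between them separates. *)
Lemma separated_by_plane_disjoint_hulls (R : realType) (A B : set (R3 R)) :
  compact A -> compact B -> A !=set0 -> B !=set0 ->
  half_space_hull A `&` half_space_hull B = set0 -> separated_by_plane A B.
Proof.
move=> cA cB [x0 Ax0] [y0 By0] AB0.
pose f (z : R3 R * R3 R) := dot (z.2 - z.1) (z.2 - z.1).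
have cf : continuous f.
  have c21 : continuous (fun z : R3 R * R3 R => z.2 - z.1).
    by move=> z; apply: cvgB; [exact: cvg_snd|exact: cvg_fst].
  exact: continuous_dot.
have [||[x y]/[!inE]/= -[Ax By] minf] := @compact_EVT_min _ _ f
    (half_space_hull A `*` half_space_hull B) _ _ (continuous_subspaceT cf).
- by exists (x0, y0); split; apply: sub_half_space_hull.
- by apply: compact_setX; exact: compact_half_space_hull.
have Ale x' : half_space_hull A x' -> dot (y - x) x' <= dot (y - x) x.
  apply: nearest_point_half_space => // x1 Ax1.
  by apply: (minf (x1, y)); rewrite inE.
have fC z w : f (z, w) = dot (z - w) (z - w).
  by rewrite /f /= -opprB dotNr dotNl opprK.
have Bge y' : half_space_hull B y' -> dot (y - x) y <= dot (y - x) y'.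
  move=> By'; rewrite -lerN2 -!dotNl opprB.
  apply: nearest_point_half_space By' => // y1 By1.
  by rewrite -!fC; apply: (minf (x, y1)); rewrite inE.
have yx : y - x != 0.
  apply/eqP => /subr0_eq yx; have : (half_space_hull A `&` half_space_hull B) x.
    by split=> //; rewrite -yx.
  by rewrite AB0.
have gap : dot (y - x) x < dot (y - x) y.
  rewrite -subr_gt0 -dotNr -dotDr lt_def dot_ge0 andbT.
  by apply: contra_neq yx; exact: dot_eq0.
exists (y - x), ((dot (y - x) x + dot (y - x) y) / 2); split=> // z.
  move=> /(@sub_half_space_hull _ A)/Ale; rewrite /side_lt /=; lra.
move=> /(@sub_half_space_hull _ B)/Bge; rewrite /side_gt /=; lra.
Qed.

(** * Closed curves meeting a plane *)

Lemma simple_closed_curve_nonempty (R : realType) (K : set (R3 R)) :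
  simple_closed_curve K -> K !=set0.
Proof.
by case=> g [_ _ _ ->]; exists (g 0), 0 => //=; rewrite in_itv /= lexx ler01.
Qed.

Lemma compact_simple_closed_curve (R : realType) (K : set (R3 R)) :
  simple_closed_curve K -> compact K.
Proof.
by case=> g [cg _ _ ->]; apply: continuous_compact cg (@segment_compact _ _ _).
Qed.

(** The intermediate value theorem; the sign of the product covers both directions of crossing and
    keeps [c] off the endpoints. *)
Lemma crossing (R : realType) (f : R -> R) (u v d : R) :
  {within `[0, 1], continuous f} -> 0 <= u -> u < v -> v <= 1 ->
  (f u - d) * (f v - d) < 0 -> exists2 c, u < c < v & f c = d.
Proof.
move=> cf u0 uv v1 sgn.
have cuv : {within `[u, v], continuous f}.
  apply: continuous_subspaceW cf => x /=; rewrite !in_itv /= => /andP[ux xv].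
  by rewrite (le_trans u0 ux) (le_trans xv v1).
have [|c] := @IVT _ f u v d (ltW uv) cuv.
  by have [fuv|fuv] := leP (f u) (f v); apply/andP; split; nra.
rewrite in_itv /= => /andP[uc cv] fc; exists c => //.
rewrite !lt_neqAle uc cv !andbT; apply/andP; split; apply/eqP => E.
  by move: sgn; rewrite E fc subrr mul0r ltxx.
by move: sgn; rewrite -E fc subrr mulr0 ltxx.
Qed.

Lemma crossing_unordered (R : realType) (f : R -> R) (u v d : R) :
  {within `[0, 1], continuous f} -> u \in `[0, 1] -> v \in `[0, 1] ->
  f u < d -> d < f v -> exists2 c, c \in `[0, 1] & f c = d.
Proof.
move=> cf; rewrite !in_itv /= => /andP[u0 u1] /andP[v0 v1] fu fv.
have [uv|vu|E] := ltgtP u v.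
- have [|c /andP[uc cv] <-] := crossing (d := d) cf u0 uv v1; first by nra.
  by exists c => //; rewrite in_itv /=; lra.
- have [|c /andP[uc cv] <-] := crossing (d := d) cf v0 vu u1; first by nra.
  by exists c => //; rewrite in_itv /=; lra.
- by exfalso; move: fu fv; rewrite E; lra.
Qed.

Lemma simple_closed_curve_one_side (R : realType) (K : set (R3 R)) (a : R3 R)
    (d : R) :
  simple_closed_curve K -> ~ ((plane a d `&` K) !=set0) ->
  K `<=` side_lt a d \/ K `<=` side_gt a d.
Proof.
case=> g [cg _ _ ->] miss; pose f t := dot a (g t).
have cf : {within `[0, 1], continuous f}.
  by move=> t; apply: continuous_comp (cg t) _; exact: dot_continuous.
have [lt_d|nlt] := pselect (g @` `[0, 1] `<=` side_lt a d); [by left|right].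
move=> _ [t t01 <-]; rewrite /side_gt /= ltNge; apply/negP => ft.
apply: nlt => _ [s s01 <-]; rewrite /side_lt /= ltNge; apply/negP => fs.
apply: miss.
have [fsd|] := eqVneq (f s) d; first by exists (g s); split=> //; exists s.
have [ftd|] := eqVneq (f t) d; first by exists (g t); split=> //; exists t.
move=> ftd fsd.
have [||c c01 fc] := @crossing_unordered _ f t s d cf t01 s01.
- by rewrite lt_neqAle ftd.
- by rewrite lt_neqAle eq_sym fsd.
by exists (g c); split=> //; exists c.
Qed.

(* A closed curve with points on both sides of a plane crosses it on each of
   the two arcs between these points. *)
Lemma simple_closed_curve_second_point (R : realType) (K : set (R3 R))
    (a x : R3 R) (d : R) :
  simple_closed_curve K -> K x ->
  (K `&` side_lt a d) !=set0 -> (K `&` side_gt a d) !=set0 ->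
  exists2 y, (plane a d `&` K) y & y != x.
Proof.
case=> g [cg g01 ginj ->] [t]; rewrite /= in_itv /= => /andP[t0 t1] gt.
(* Parameter 1 is traded for 0, since injectivity holds only on [[0, 1[]. *)
have {t t0 t1 gt} [t [t0 t1 gt]] : exists t : R, [/\ 0 <= t, t < 1 & g t = x].
  have [E|tn1] := eqVneq t 1.
    by exists 0; split; rewrite ?lexx ?ltr01 // g01 -E.
  by exists t; split=> //; rewrite lt_neqAle tn1.
move=> [_ [[u u01 <-] gu]] [_ [[v v01 <-] gv]].
pose f t := dot a (g t).
have cf : {within `[0, 1], continuous f}.
  by move=> s; apply: continuous_comp (cg s) _; exact: dot_continuous.
have neq s : 0 <= s < 1 -> s != t -> f s = d ->
    exists2 y, (plane a d `&` g @` `[0, 1]) y & y != x.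
  move=> /andP[s0 s1] st fs; exists (g s).
    by split=> //; exists s => //=; rewrite in_itv /= s0 ltW.
  rewrite -gt; apply: contra_neq st => gst; apply: ginj gst.
    by rewrite in_itv /= s0.
  by rewrite in_itv /= t0.
have {u v u01 v01 gu gv} [u [v [u0 uv v1 sgn]]] :
    exists u v, [/\ 0 <= u, u < v, v <= 1 & (f u - d) * (f v - d) < 0].
  move: u01 v01 gu gv; rewrite /= !in_itv /side_lt /side_gt /= -/(f u) -/(f v).
  move=> /andP[u0 u1] /andP[v0 v1] fu fv.
  have [uv|vu|E] := ltgtP u v.
  - by exists u, v; split=> //; nra.
  - by exists v, u; split=> //; nra.
  - by exfalso; move: fu fv; rewrite E; lra.
have cross p q : 0 <= p -> p < q -> q <= 1 -> ~~ (p < t < q) ->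
    (f p - d) * (f q - d) < 0 ->
    exists2 y, (plane a d `&` g @` `[0, 1]) y & y != x.
  move=> p0 pq q1 tpq fpq; have [c /andP[pc cq] fc] := crossing cf p0 pq q1 fpq.
  apply: (neq c) => //; first by apply/andP; split; lra.
  by apply: contraNneq tpq => <-; rewrite pc.
have [/andP[ut tv]|tuv] := boolP (u < t < v); last exact: (cross u v).
(* Now [u < t < v], so the other arc is used: [[v, 1]] followed by [[0, u]]. The base point lies on
   the plane, or opposite [g u], or else opposite [g v]. *)
have f01 : f 1 = f 0 by rewrite /f g01.
have [f0d|f0d] := eqVneq (f 0) d.
  apply: (neq 0) => //; first by rewrite lexx ltr01.
  by rewrite lt_eqF // (le_lt_trans u0).
have [fu0|fu0] := ltP ((f 0 - d) * (f u - d)) 0.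
  apply: (cross 0 u) => //; last 2 first.
  - by lra.
  - by rewrite negb_and -!leNgt (ltW ut) orbT.
  - by rewrite lt_neqAle u0 andbT; apply: contraTneq fu0 => <-;
       rewrite -leNgt -expr2 sqr_ge0.
have fv0 : (f v - d) * (f 1 - d) < 0.
  have := f0d; rewrite f01 -subr_eq0 => f0d'; move: sgn fu0.
  case: (ltgtP (f u - d) 0) => [lt0|gt0|->]; last by rewrite mul0r ltxx.
    rewrite nmulr_rlt0 // nmulr_lge0 // => fv0 f00.
    by rewrite pmulr_rlt0 // lt_neqAle f0d'.
  rewrite pmulr_rlt0 // pmulr_lge0 // => fv0 f00.
  by rewrite nmulr_rlt0 // lt_neqAle eq_sym f0d'.
apply: (cross v 1) => //; first by rewrite (le_trans u0) ?ltW.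
  rewrite lt_neqAle v1 andbT; apply: contraTneq fv0 => ->.
  by rewrite -leNgt -expr2 sqr_ge0.
by rewrite negb_and -!leNgt (ltW tv).
Qed.

(** * A central point for curves no two of which are separated *)

(** The hull only sees closed half-spaces. Strictness survives because each compact [K i] attains a
    maximum below [d], and there are finitely many of them. *)
Lemma half_space_hull_open_side (R : realType) (T : finType) (M : {set T})
    (K : T -> set (R3 R)) (a c : R3 R) (d : R) :
  (forall i, i \in M -> compact (K i) /\ K i !=set0) ->
  (forall i, i \in M -> K i `<=` side_lt a d) ->
  half_space_hull (\bigcup_(i in [set` M]) K i) c -> dot a c < d.
Proof.
move=> cK Klt Kc.
have /choice[m mP] i :
    exists m, i \in M -> m < d /\ forall y, K i y -> dot a y <= m.
  have [iM|_] := boolP (i \in M); last by exists 0.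
  have [cKi Ki0] := cK i iM.
  have [z zK maxz] := compact_EVT_max Ki0 cKi
    (continuous_subspaceT (@dot_continuous R a)).
  rewrite inE in zK; exists (dot a z) => _; split; first exact: Klt zK.
  by move=> y Ky; apply: maxz; rewrite inE.
(* The default [d - 1] keeps [e < d] even when [M] is empty. *)
pose e := \big[Order.max/(d - 1)]_(i in M) m i.
have ed : e < d.
  by apply: bigmax_lt => [|i /mP[]//]; rewrite ltrBlDr ltrDl.
apply: le_lt_trans ed; apply: Kc => y [i /= iM Kiy].
by apply: le_trans ((mP i iM).2 y Kiy) _; exact: le_bigmax_cond.
Qed.

Lemma central_point (R : realType) (p : nat) (K : 'I_p -> set (R3 R)) :
  (forall i, simple_closed_curve (K i)) ->
  (forall i j, i != j -> ~ separated_by_plane (K i) (K j)) ->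
  exists c : R3 R, forall (a : R3 R) (d : R), a != 0 -> plane a d c ->
    (3 * p <= 5 * #|[set i | `[< (plane a d `&` K i) !=set0 >]]%SET|)%N.
Proof.
move=> sccK nsep.
have cK i : compact (K i) by exact: compact_simple_closed_curve.
have K0 i : K i !=set0 by exact: simple_closed_curve_nonempty.
pose J := {I : {set 'I_p} | (2 * p < 5 * #|I|)%N}.
pose U (I : {set 'I_p}) := half_space_hull (\bigcup_(i in [set` I]) K i).
have subU i (I : {set 'I_p}) : i \in I -> half_space_hull (K i) `<=` U I.
  by move=> iI; apply: half_space_hullS => x Kx; exists i.
have [c Uc] : exists c : R3 R, forall I : J, U (val I) c.
  apply: (@helly R 3 J (fun I => U (val I))).
    by move=> I; exact: convex_half_space_hull.
  move=> f.
  have [k|i [j ij]] := @four_large_sets_covered _ (fun k => val (f k)).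
    by rewrite card_ord; exact: (valP (f k)).
  have [z [iz jz]] : (half_space_hull (K i) `&` half_space_hull (K j)) !=set0.
    have [<-|/nsep] := eqVneq i j.
      rewrite setIid; have [x Kx] := K0 i; exists x.
      exact: sub_half_space_hull.
    apply: contra_notP => /set0P/negP/negPn/eqP.
    exact: separated_by_plane_disjoint_hulls.
  by exists z => k; have [/subU|/subU] := ij k; apply.
exists c => a d a0 acd; set H := [set i | _]%SET.
rewrite leqNgt; apply/negP => Hp.
pose M := (~: H)%SET.
have Mp : (2 * p < 5 * #|M|)%N.
  by have := cardsC H; rewrite card_ord -/M; lia.
have UM : U M c := Uc (exist _ M Mp).
have cK0 i : i \in M -> compact (K i) /\ K i !=set0 by split.
have side i : i \in M -> K i `<=` side_lt a d \/ K i `<=` side_gt a d.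
  rewrite !inE => /asboolPn; exact: simple_closed_curve_one_side.
have [lt_d|] := pselect (forall i, i \in M -> K i `<=` side_lt a d).
  have := half_space_hull_open_side cK0 lt_d UM.
  by rewrite (acd : dot a c = d) ltxx.
move=> /existsNP[i /not_implyP[iM nlt]].
have igt : K i `<=` side_gt a d by case: (side i iM).
(* One curve of [M] on the upper side forces all of them there, as the plane would otherwise
   separate two. Negating the equation turns this into the lower side. *)
have gt_d j : j \in M -> K j `<=` side_lt (- a) (- d).
  move=> jM x Kjx; rewrite /side_lt /= dotNl ltrN2.
  have [ji|ji] := eqVneq j i; first by apply: igt; rewrite -ji.
  case: (side j jM) => [jlt|]; last exact.
  exfalso; apply: (nsep j i ji); by exists a, d.
have := half_space_hull_open_side cK0 gt_d UM.
by rewrite dotNl (acd : dot a c = d) ltxx.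
Qed.

(** * Images under homeomorphisms and intersection counts *)

Lemma simple_closed_curve_image (R : realType) (h : R3 R -> R3 R)
    (K : set (R3 R)) :
  homeomorphism h -> simple_closed_curve K -> simple_closed_curve (h @` K).
Proof.
case=> h' [ch _ hK _] [g [cg g01 ginj ->]]; exists (h \o g); split.
- by move=> t; apply: continuous_comp (cg t) _; exact: ch.
- by rewrite /= g01.
- by move=> s t sI tI /(can_inj hK); exact: ginj.
- by rewrite image_comp.
Qed.

Lemma disjoint_curves_image (R : realType) (p : nat) (h : R3 R -> R3 R)
    (K : 'I_p -> set (R3 R)) :
  homeomorphism h -> disjoint_curves K -> disjoint_curves (fun i => h @` K i).
Proof.
move=> hh [sccK tK]; split=> [i|i j _ _].
  exact: simple_closed_curve_image.
case: hh => h' [_ _ hK _] [_ [[x Kix <-] [y Kjy /(can_inj hK) yx]]].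
by apply: tK => //; exists x; split=> //; rewrite -yx.
Qed.

(** A point without change of sides already counts 2. Otherwise [K i] has points on both sides,
    hence a second point on the plane, and each counts at least 1. *)
Lemma component_intersection_count (R : realType) (p : nat)
    (K : 'I_p -> set (R3 R)) (a : R3 R) (d : R) (i : 'I_p) :
  disjoint_curves K -> (plane a d `&` K i) !=set0 ->
  (2%:E <= \esum_(x in plane a d `&` K i)
     (if `[< changes_sides a d (\bigcup_i K i) x >] then 1%:E
      else 2%:E : \bar R))%E.
Proof.
move=> [sccK tK] [x [ax Kx]]; set w := fun x => (if _ then _ else _).
have w1 z : (1%:E <= w z)%E by rewrite /w; case: ifP; rewrite lee_fin ?ler1n.
have [[cl_lt cl_gt]|ncs] :=
    pselect (changes_sides a d (\bigcup_i K i) x); last first.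
  apply: esum_ge; exists [set x].
    by split; [exact: finite_set1|move=> _ ->].
  by rewrite fsbig_set1 /w asboolF.
(* Sides change for the whole union; this neighbourhood of [x] excludes the other components, so the
   change is due to [K i]. *)
pose V := ~` (\bigcup_(j in [set j | j != i]) K j).
have Vx : nbhs x V.
  apply: open_nbhs_nbhs; split.
    apply: closed_openC; apply: closed_bigcup; first exact: finite_finset.
    move=> j _; apply: compact_closed; first exact: norm_hausdorff.
    exact: compact_simple_closed_curve.
  move=> [j /= ji Kjx]; move/eqP: ji; apply; apply: tK => //.
  by exists x.
have near (S : set (R3 R)) :
    closure (\bigcup_i K i `&` S) x -> (K i `&` S) !=set0.
  move=> /(_ V Vx)[y [[[j _ Kjy] Sy] Vy]]; exists y; split=> //.
  have [<-//|ji] := eqVneq j i.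
  by exfalso; apply: Vy; exists j.
have [y Iy yx] := simple_closed_curve_second_point (sccK i) Kx
  (near _ cl_lt) (near _ cl_gt).
apply: esum_ge; exists ([set x] `|` [set y]).
  by split; [rewrite finite_setU; split; exact: finite_set1|move=> _ [->|->]].
rewrite fsbigU0 ?fsbig_set1 //; last first.
  by move=> z [-> /esym/eqP]; rewrite (negbTE yx).
have -> : 2%:E = (1%:E + 1%:E)%E :> \bar R by rewrite -EFinD.
exact: leeD (w1 x) (w1 y).
Qed.

Lemma intersection_count_ge (R : realType) (p : nat) (K : 'I_p -> set (R3 R))
    (a : R3 R) (d : R) :
  disjoint_curves K ->
  ((2 * #|[set i | `[< (plane a d `&` K i) !=set0 >]]%SET|)%:R%:E <=
    intersection_count a d (\bigcup_i K i))%E.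
Proof.
move=> dK; rewrite /intersection_count; case: ifP => _; last exact: leey.
set H := [set i | _]%SET; set w := fun x => (if _ then _ else _).
have w0 z : (0 <= w z)%E by rewrite /w; case: ifP => _; rewrite lee_fin.
have -> : (2 * #|H|)%:R%:E = (\sum_(i in H) 2%:E)%E :> \bar R.
  by rewrite sumEFin sumr_const mulnC natrM mulr_natl.
apply: (@le_trans _ _ (\sum_(i in H) \esum_(x in plane a d `&` K i) w x)%E).
  apply: lee_sum => i; rewrite inE => /asboolP.
  exact: component_intersection_count.
(* A common index set with indicators lets the sums be exchanged; by disjointness each point then
   contributes to at most one component. *)
under eq_bigr => i _.
  rewrite (_ : plane a d `&` K i =
    plane a d `&` \bigcup_i K i `&` K i); last first.
    rewrite -setIA; congr (_ `&` _); apply/seteqP.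
    by split=> [x Kx|x []//]; split=> //; exists i.
  rewrite esum_mkcondr; over.
rewrite -esum_sum; last first.
  by move=> x i _ _; case: (x \in K i); first exact: w0.
apply: le_esum => x _.
have [[i [iH Kix]]|nH] := pselect (exists i, i \in H /\ K i x); last first.
  rewrite big1 => [|i iH]; first exact: w0.
  by case: ifPn => // /set_mem Kix; case: nH; exists i.
rewrite (bigD1 i) //= mem_set // big1 ?adde0 // => j /andP[_ ji].
case: ifPn => // /set_mem Kjx; move/eqP: ji; case.
by apply: dK.2 => //; exists x.
Qed.

(** The map [h] lets this serve both the given curves, with the identity, and their isotopic copies,
    with the final map of the isotopy. *)
Lemma linked_not_separated (R : realType) (h : R3 R -> R3 R)
    (A B : set (R3 R)) :
  linked A B -> ambient_isotopic (A `|` B) (h @` A `|` h @` B) ->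
  simple_closed_curve (h @` A) -> simple_closed_curve (h @` B) ->
  ~ separated_by_plane (h @` A) (h @` B).
Proof. by move=> lAB iso sA sB sep; apply: lAB; exists (h @` A), (h @` B). Qed.

(** * The bounds for the given link and for its hull number *)

Unset Implicit Arguments.

Theorem theorem3 (R : realType) (p : nat) (L : 'I_p -> set (R3 R))
    (hL : disjoint_curves L)
    (hlinked : forall i j : 'I_p, i != j -> linked (L i) (L j)) :
  (exists c : R3 R, forall (a : R3 R) (d : R),
      a != 0 -> plane a d c ->
      3 / 5 * p%:R
        <= #|[set i : 'I_p | `[< (plane a d `&` L i) !=set0 >] ]%SET|%:R :> R)
  /\ ((3 / 5 * p%:R)%:E <= hull_number (\bigcup_i L i))%E.
Proof.
have ratio (n : nat) : (3 * p <= 5 * n)%N -> 3 / 5 * p%:R <= n%:R :> R.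
  by rewrite -(ler_nat R) !natrM; lra.
split.
  have [|i j ij|c cP] := @central_point R p L; [exact: hL.1| |].
    rewrite -(image_id (L i)) -(image_id (L j)).
    apply: linked_not_separated; rewrite ?image_id;
      [exact: hlinked| |exact: hL.1|exact: hL.1].
    exists (fun _ => id); split=> //; last by rewrite image_id.
      apply: continuous_subspaceT => z; exact: cvg_snd.
    by move=> t _; exists id; split=> // x; exact: cvg_id.
  by exists c => a d a0 /(cP a d a0)/ratio.
(* The ceiling of 3p/5, because hull numbers range over integers. *)
pose n := ((3 * p + 4) %/ 5)%N.
have n_min m : (3 * p <= 5 * m)%N -> (n <= m)%N by rewrite /n; lia.
apply: le_trans (_ : n%:R%:E <= _)%E.
  by rewrite lee_fin; apply: ratio; rewrite /n; lia.
apply: ereal_sup_ubound; exists n => // L' _ [H [cH homH H0 <-]].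
have h1 : homeomorphism (H 1) by apply: homH; rewrite in_itv /= ler01 lexx.
pose K i := H 1 @` L i.
have dK : disjoint_curves K by exact: disjoint_curves_image.
have [|i j ij|c cP] := @central_point R p K; [exact: dK.1| |].
  apply: linked_not_separated; [exact: hlinked| |exact: dK.1|exact: dK.1].
  by exists H; split=> //; rewrite image_setU.
exists c => a d a0 /(cP a d a0) acd; rewrite image_bigcup.
apply: le_trans (intersection_count_ge a d dK).
by rewrite lee_fin ler_nat leq_mul2l /=; exact: n_min.
Qed.
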